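(* Let $G=(V,E)$ be a finite simple $k$-regular graph of order $n$. Then $d_t(G,i)=\binom{n}{i}$ for all $i>n-k$.
   Context: For a finite simple graph $G=(V,E)$, a set $D\subseteq V$ is a total dominating set if every vertex of $V$ is adjacent to some vertex of $D$. $d_t(G,i)$ is the number of total dominating sets of $G$ of cardinality $i$. *)

(* Defs.v *)
From mathcomp Require Import all_boot.

Set Implicit Arguments.
Unset Strict Implicit.
Unset Printing Implicit Defensive.

(* A finite simple graph is given by a finite vertex type [V] and an adjacency
   relation [e : rel V]. *)
Definition simple_graph (V : finType) (e : rel V) : Prop :=
  symmetric e /\ irreflexive e.

Definition nbh (V : finType) (e : rel V) (v : V) : {set V} := [set u | e v u].

Definition degree (V : finType) (e : rel V) (v : V) : nat := #|nbh e v|.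

Definition regular (V : finType) (e : rel V) (k : nat) : Prop :=
  forall v : V, degree e v = k.

Definition total_dominating (V : finType) (e : rel V) (D : {set V}) : bool :=
  [forall v, exists u in D, e v u].

Definition d_t (V : finType) (e : rel V) (i : nat) : nat :=
  #|[set D : {set V} | total_dominating e D & #|D| == i]|.

(* Main.v *)
Require Import Defs.
From mathcomp Require Import all_boot.

(** Pigeonhole: more than [n - k] vertices cannot all avoid a neighbourhood of size [k], so every
    set of size [i] meets every neighbourhood, and [d_t] counts all [i]-subsets. *)

Lemma total_dominating_large (V : finType) (e : rel V) (D : {set V}) :
  (forall v, #|V| < #|D| + degree e v) -> total_dominating e D.
Proof.
move=> large; apply/forallP => v.
have : D :&: nbh e v != set0.
  (* If disjoint, [D] and [nbh e v] have a union of size [#|D| + degree e v], exceeding [#|V|]. *)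
  apply/eqP => disj; have := large v; rewrite /degree -cardsUI disj cards0 addn0.
  by rewrite ltnNge max_card.
by case/set0Pn => u; rewrite !inE => Duv; apply/existsP; exists u.
Qed.

Theorem lemma3p2 (V : finType) (e : rel V) (n k : nat)
    (simple_e : simple_graph e) (order_e : #|V| = n) (regular_e : regular e k)
    (i : nat) (lt_i : n < i + k) :
  d_t e i = 'C(n, i).
Proof.
rewrite -order_e -card_draws; apply: eq_card => D; rewrite !inE.
(* Cardinality [i] alone forces domination. *)
apply: andb_idl => /eqP cardD.
by apply: total_dominating_large => v; rewrite regular_e cardD order_e.
Qed.
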